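(* Consider pairs of positive integers $(N,M)$ with $M+2\le N\le128$. A pair admits a temperature-independent optimal permutation with identical one-qubit target marginals (equivalently, a temperature-independent optimal permutation that is shell-wise one-body balanced) if and only if it is one of the following (where $a$–$b$ denotes all integers $N$ with $a\le N\le b$): - $M=2$: $N\in$ 5–7, 9–14, 17–29, 33–59, 65–121; - $M=3$: $N\in$ 9–14, 27–47, 63, 81–128; - $M=4$: $N\in$ 10, 18–19, 25, 34–35, 49–53, 66–69, 81–83, 97–112; - $M=5$: $N\in$ 25–39, 75–83, 125–128; - $M=6$: $N\in$ 18–20, 57–58; - $M=7$: $N\in$ 49–77; - $M=8$: $N\in$ 67, 98–100; - $M=11$: $N\in$ 121–128. In particular, no such pair occurs for any value of $M$ not in this list. Moreover, among the listed pairs, those that fail the Hamming-symmetric divisibility condition ($\binom Mw\mid c_{w,k}$ for every $w,k$), i.e. that admit no shell-by-shell Hamming-symmetric optimal permutation, while satisfying the local-balance condition ($M\mid w\,c_{w,k}$ for every $w=1,\dots,M-1$ and $k=0,\dots,N$), are exactly the following 58: $M=4$: $N\in$ 18–19, 25, 52–53, 69; $M=5$: $N\in$ 29–32, 125–128; $M=6$: $N\in$ 18–20, 57–58; $M=7$: $N\in$ 49–54, 56–77; $M=8$: $N\in$ 98–100; $M=11$: $N\in$ 121–128. All the other listed pairs satisfy the Hamming-symmetric divisibility condition, i.e. admit a shell-by-shell Hamming-symmetric optimal permutation.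
   Context: Setting: $N$ qubits, computational basis indexed by $\{0,1\}^N$; the first $M$ qubits are the targets. ''Shell $k$'' is the set of the $\binom Nk$ strings with $k$ ones; in the thermal state $\rho(P_1)=(P_0|0\rangle\langle0|+P_1|1\rangle\langle1|)^{\otimes N}$, $P_0=1-P_1$, $0<P_1<1/2$, these have eigenvalue $q_k=P_0^{N-k}P_1^k$. The target-weight-$w$ sector is the set of strings whose first $M$ bits have Hamming weight $w$. Passive multiplicities: with $B_k=\sum_{j=0}^k\binom Nj$, $B_{-1}=0$, and $G_w=2^{N-M}\sum_{r=0}^w\binom Mr$, $G_{-1}=0$, set $c_{w,k}=\max\{0,\min(B_k,G_w)-\max(B_{k-1},G_{w-1})\}$ for $w=0,\dots,M$ and $k=0,\dots,N$. A temperature-independent optimal permutation is a permutation $\pi$ of $\{0,1\}^N$ sending exactly $c_{w,k}$ strings of shell $k$ into target sector $w$, for all $w,k$ (equivalently, for every $P_1\in(0,1/2)$ the unitary $U_\pi|b\rangle=|\pi(b)\rangle$ minimizes $\operatorname{Tr}(\sum_{\alpha\le M}|1\rangle\langle1|_\alpha U\rho(P_1)U^\dagger)$ over all unitaries $U$). It has identical one-qubit target marginals if for every $P_1\in(0,1/2)$ the reduced states of the $M$ target qubits in $U_\pi\rho(P_1)U_\pi^\dagger$ coincide. For $x\in\{0,1\}^M$ let $n_{x,k}$ be the number of shell-$k$ strings that $\pi$ sends to strings whose first $M$ bits equal $x$. The permutation $\pi$ is shell-wise one-body balanced if $\sum_x x_\alpha n_{x,k}=\sum_x x_\gamma n_{x,k}$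 for all target positions $\alpha,\gamma\in\{1,\dots,M\}$ and all $k$; it is shell-by-shell Hamming symmetric if $n_{x,k}=n_{y,k}$ for all $k$ whenever $x,y$ have the same Hamming weight.
   Formalization: The classification is stated for M ≥ 2 only: for M = 1 the identical-marginals condition is vacuous and an optimal permutation always exists (e.g. N = 3), so the claim that no pair with M = 1 occurs is false. *)

(* Defs.v *)
From HB Require Import structures.
From mathcomp Require Import all_boot all_order all_algebra all_fingroup.
From mathcomp Require Import reals.
From mathcomp Require Import complex.
Set Implicit Arguments.
Unset Strict Implicit.
Unset Printing Implicit Defensive.
Import Order.TTheory GRing.Theory Num.Theory.

(* A computational basis string is an N.-tuple bool, with true for the bit 1;
   position 0 is the first qubit, and the targets are the positions < M. *)
Notation bits N := (N.-tuple bool).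

Definition hweight (s : seq bool) : nat := count_mem true s.

(* Index shift: cumB N k is B_{k-1} and cumG N M w is G_{w-1}, so that
   cumB N 0 = B_{-1} = 0 and cumG N M 0 = G_{-1} = 0. *)
Definition cumB (N k : nat) : nat := \sum_(j < k) 'C(N, j).
Definition cumG (N M w : nat) : nat := 2 ^ (N - M) * \sum_(r < w) 'C(M, r).

(* The truncated subtraction on nat plays the role of max {0, _}. *)
Definition passive_mult (N M w k : nat) : nat :=
  minn (cumB N k.+1) (cumG N M w.+1) - maxn (cumB N k) (cumG N M w).

Definition optimal_perm (N M : nat) (pi : {perm bits N}) : Prop :=
  forall w k : nat, w <= M -> k <= N ->
    #|[set s : bits N | (hweight s == k) && (hweight (take M (pi s)) == w)]|
    = passive_mult N M w k.

Definition prefix_count (N M : nat) (pi : {perm bits N}) (x : bits M)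
    (k : nat) : nat :=
  #|[set s : bits N | (hweight s == k) && (take M (pi s) == x :> seq bool)]|.

Definition shellwise_balanced (N M : nat) (pi : {perm bits N}) : Prop :=
  forall (alpha gamma : 'I_M) (k : nat), k <= N ->
    \sum_(x : bits M) tnth x alpha * prefix_count pi x k
    = \sum_(x : bits M) tnth x gamma * prefix_count pi x k.

Definition hamming_symmetric (N M : nat) (pi : {perm bits N}) : Prop :=
  forall (x y : bits M) (k : nat), k <= N -> hweight x = hweight y ->
    prefix_count pi x k = prefix_count pi y k.

Definition hamming_divisible (N M : nat) : Prop :=
  forall w k : nat, w <= M -> k <= N -> 'C(M, w) %| passive_mult N M w k.

Definition locally_balanced (N M : nat) : Prop :=
  forall w k : nat, 1 <= w <= M.-1 -> k <= N -> M %| w * passive_mult N M w k.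

Section QuantumStates.
Local Open Scope ring_scope.
Local Open Scope complex_scope.
Variable R : realType.

(* Operators on the Hilbert space with orthonormal basis indexed by T. *)
Notation operator T := 'M[R[i]]_#|{: T}|.

Definition entry (T : finType) (A : operator T) (s t : T) : R[i] :=
  A (enum_rank s) (enum_rank t).

Definition of_entries (T : finType) (f : T -> T -> R[i]) : operator T :=
  \matrix_(i, j) f (enum_val i) (enum_val j).

Definition ketbra (T : finType) (s t : T) : operator T :=
  delta_mx (enum_rank s) (enum_rank t).

Definition adjoint (T : finType) (A : operator T) : operator T :=
  map_mx Num.conj A^T.

Definition tensor_power (N : nat) (A : operator bool) : operator (bits N) :=
  of_entries (fun s t => \prod_(l < N) entry A (tnth s l) (tnth t l)).

Definition thermal_qubit (P1 : R) : operator bool :=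
  (1 - P1)%:C *: ketbra false false + P1%:C *: ketbra true true.

Definition thermal_state (N : nat) (P1 : R) : operator (bits N) :=
  tensor_power N (thermal_qubit P1).

Definition perm_unitary (N : nat) (pi : {perm bits N}) : operator (bits N) :=
  \sum_(b : bits N) ketbra (pi b) b.

Definition evolved_state (N : nat) (pi : {perm bits N}) (P1 : R) :
    operator (bits N) :=
  perm_unitary pi *m thermal_state N P1 *m adjoint (perm_unitary pi).

(* Partial trace over all qubits except alpha. *)
Definition reduced_state (N : nat) (alpha : 'I_N) (A : operator (bits N)) :
    operator bool :=
  of_entries (fun a b =>
    \sum_(s : bits N | tnth s alpha == a)
      \sum_(t : bits N | (tnth t alpha == b) &&
          [forall l, (l != alpha) ==> (tnth s l == tnth t l)])
        entry A s t).

Definition identical_marginals (N M : nat) (pi : {perm bits N}) : Prop :=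
  forall P1 : R, 0 < P1 < 2^-1 ->
  forall alpha gamma : 'I_N, (alpha < M)%N -> (gamma < M)%N ->
    reduced_state alpha (evolved_state pi P1)
    = reduced_state gamma (evolved_state pi P1).

End QuantumStates.

Definition listed (N M : nat) : bool :=
  match M with
  | 2 => [|| 5 <= N <= 7, 9 <= N <= 14, 17 <= N <= 29, 33 <= N <= 59
           | 65 <= N <= 121]
  | 3 => [|| 9 <= N <= 14, 27 <= N <= 47, N == 63 | 81 <= N <= 128]
  | 4 => [|| N == 10, 18 <= N <= 19, N == 25, 34 <= N <= 35, 49 <= N <= 53,
             66 <= N <= 69, 81 <= N <= 83 | 97 <= N <= 112]
  | 5 => [|| 25 <= N <= 39, 75 <= N <= 83 | 125 <= N <= 128]
  | 6 => (18 <= N <= 20) || (57 <= N <= 58)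
  | 7 => 49 <= N <= 77
  | 8 => (N == 67) || (98 <= N <= 100)
  | 11 => 121 <= N <= 128
  | _ => false
  end.

Definition listed_asymmetric (N M : nat) : bool :=
  match M with
  | 4 => [|| 18 <= N <= 19, N == 25, 52 <= N <= 53 | N == 69]
  | 5 => (29 <= N <= 32) || (125 <= N <= 128)
  | 6 => (18 <= N <= 20) || (57 <= N <= 58)
  | 7 => (49 <= N <= 54) || (56 <= N <= 77)
  | 8 => 98 <= N <= 100
  | 11 => 121 <= N <= 128
  | _ => false
  end.

(* Main.v *)
Require Import Defs.
From HB Require Import structures.
From mathcomp Require Import all_boot all_order all_algebra all_fingroup.
From mathcomp Require Import reals.
From mathcomp Require Import complex.
From mathcomp Require Import zify.
From Stdlib Require BinNat Nnat.
Set Implicit Arguments.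
Unset Strict Implicit.
Unset Printing Implicit Defensive.

(** The marginal of target i in U_pi rho(P_1) U_pi^* is determined by the numbers m_{i,k} of
    shell-k strings sent to strings with bit i set: its excited population is the sum of
    m_{i,k} q_k.  As a polynomial in P_1 / (1 - P_1) this determines every m_{i,k}, so
    identical marginals amount to shell-wise one-body balance.

    Necessity.  Balance of shell k forces M to divide the sum over w of w c_{w,k}, hence, by
    summing over the first shells, M divides the total target weight of the first B_k
    positions of the passive filling.  For every pair outside the list this fails for some k.

    Sufficiency.  Any counts n_{x,k} with shell totals binom(N,k) and prefix totals 2^(N-M)
    come from a permutation.  If binom(M,w) divides c_{w,k}, take n_{x,k} = c_{w,k} / binom(M,w).
    If only M | w c_{w,k}, then M / gcd(M,w) divides c_{w,k}, and it is enough to partition the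
    weight-w strings into balanced blocks of M / gcd(M,w) strings and to deal 2^(N-M) copies of
    these blocks out to the shells. *)

(** * Passive multiplicities and permutations with prescribed prefix counts *)

Lemma cumBS N k : cumB N k.+1 = cumB N k + 'C(N, k).
Proof. exact: big_ord_recr. Qed.

Lemma cumGS N M w : cumG N M w.+1 = cumG N M w + 2 ^ (N - M) * 'C(M, w).
Proof. by rewrite /cumG big_ord_recr mulnDr. Qed.

Lemma sum_bin n : \sum_(i < n.+1) 'C(n, i) = 2 ^ n.
Proof.
rewrite -[2]/(1 + 1) expnDn; apply: eq_bigr => i _.
by rewrite !exp1n !muln1.
Qed.

Lemma cumB_full N : cumB N N.+1 = 2 ^ N.
Proof. exact: sum_bin. Qed.

Lemma cumG_full N M : M <= N -> cumG N M M.+1 = 2 ^ N.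
Proof. by move=> leMN; rewrite /cumG sum_bin -expnD subnK. Qed.

Lemma leq_cumB N : {homo cumB N : j k / j <= k}.
Proof.
by apply: homo_leq => // [|k]; [exact: leq_trans|rewrite cumBS leq_addr].
Qed.

Lemma leq_cumG N M : {homo cumG N M : v w / v <= w}.
Proof.
by apply: homo_leq => // [|w]; [exact: leq_trans|rewrite cumGS leq_addr].
Qed.

(** The number of the first [p] positions of the passive filling that fall into sector [w]: the
    length of the part of [[G_{w-1}, G_w)] below [p]. *)
Definition sector_part N M w p := minn p (cumG N M w.+1) - cumG N M w.

(** Shells and sectors are two families of consecutive intervals starting at 0, and [passive_mult]
    is the length of an overlap; the overlaps of one sector with successive shells therefore add
    up. *)
Lemma sum_passive_shells N M w k :
  \sum_(j < k) passive_mult N M w j = sector_part N M w (cumB N k).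
Proof.
have leG : cumG N M w <= cumG N M w.+1 by apply: leq_cumG.
rewrite /sector_part; elim: k => [|k IHk].
  by rewrite big_ord0 /cumB big_ord0 min0n.
rewrite big_ord_recr /= IHk /passive_mult.
have : cumB N k <= cumB N k.+1 by apply: leq_cumB.
lia.
Qed.

Lemma sum_passive_shells_full N M w : M <= N -> w <= M ->
  \sum_(k < N.+1) passive_mult N M w k = 2 ^ (N - M) * 'C(M, w).
Proof.
move=> leMN lewM; rewrite sum_passive_shells /sector_part cumB_full.
rewrite -(cumG_full leMN) (cumGS _ _ w).
have := @leq_cumG N M w.+1 M.+1 lewM; rewrite (cumGS _ _ w); lia.
Qed.

Lemma sum_passive_sectors N M k : M <= N -> k <= N ->
  \sum_(w < M.+1) passive_mult N M w k = 'C(N, k).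
Proof.
move=> leMN lekN.
have leB : cumB N k <= cumB N k.+1 by apply: leq_cumB.
(* Generalized for induction: the overlap of shell [k] with the first [m] sectors. Truncated
   subtraction gives 0 as long as these sectors end before the shell begins. *)
have sum_lt m : \sum_(w < m) passive_mult N M w k
    = minn (cumG N M m) (cumB N k.+1) - cumB N k.
  elim: m => [|m IHm]; first by rewrite big_ord0 /cumG big_ord0; lia.
  rewrite big_ord_recr /= IHm /passive_mult.
  have : cumG N M m <= cumG N M m.+1 by apply: leq_cumG.
  lia.
rewrite sum_lt cumG_full // -cumB_full (cumBS _ k).
have := @leq_cumB N k.+1 N.+1 lekN; rewrite (cumBS _ k); lia.
Qed.

Lemma hweight_sum n (x : bits n) : hweight x = \sum_(i < n) tnth x i.
Proof.
rewrite /hweight -sum1_count big_mkcond big_tuple.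
by apply: eq_bigr => i _; case: (tnth x i).
Qed.

Lemma hweight_leq n (x : bits n) : hweight x <= n.
Proof. by rewrite -[X in _ <= X](size_tuple x) count_size. Qed.

(** A string corresponds to the set of positions of its ones, and [card_draws] counts the sets of
    size [k]. *)
Lemma card_hweight n k : #|[set s : bits n | hweight s == k]| = 'C(n, k).
Proof.
pose F (s : bits n) := [set i | tnth s i].
have hwF s : #|F s| = hweight s.
  rewrite hweight_sum -sum1_card big_mkcond; apply: eq_bigr => i _.
  by rewrite inE; case: (tnth s i).
have Finj : injective F.
  by move=> s t /setP eqF; apply: eq_from_tnth => i; have := eqF i; rewrite !inE.
rewrite -[n in RHS]card_ord -card_draws -(card_imset _ Finj).
apply: eq_card => A; rewrite !inE; apply/imsetP/eqP => [[s]|<-].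
  by rewrite inE => /eqP <- ->.
have eA : A = F [tuple i \in A | i < n].
  by apply/setP => i; rewrite !inE tnth_mktuple.
by exists [tuple i \in A | i < n]; rewrite // inE -hwF -eA.
Qed.

(** The fibres over [a] are matched by rank: the element of index [j] in the fibre of [g] goes to
    the element of index [j] in the fibre of [h]. *)
Lemma perm_of_fibres (T : finType) (A : eqType) (g h : T -> A) :
  (forall a, #|[set t | g t == a]| = #|[set t | h t == a]|) ->
  exists pi : {perm T}, forall t, h (pi t) = g t.
Proof.
move=> eqgh.
pose fg a := enum [set t | g t == a]; pose fh a := enum [set t | h t == a].
pose f t := nth t (fh (g t)) (index t (fg (g t))).
have mem_fg t : t \in fg (g t) by rewrite mem_enum inE.
have lt_fh t : index t (fg (g t)) < size (fh (g t)).
  by rewrite -cardE -eqgh cardE index_mem.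
have hf t : h (f t) = g t.
  by have := mem_nth t (lt_fh t); rewrite mem_enum inE => /eqP.
have finj : injective f.
  move=> t u eqf; have eqg : g t = g u by rewrite -!hf eqf.
  move/eqP: eqf; rewrite /f -eqg (set_nth_default t); last by rewrite eqg.
  rewrite nth_uniq ?enum_uniq //; last by rewrite eqg.
  by move/eqP; apply: index_inj; rewrite // eqg.
by exists (perm finj) => t; rewrite permE.
Qed.

(** The list [L] holds [c a] copies of each label [a]; reading it along the enumeration of [P]
    labels the elements. *)
Lemma labelling_of_counts (T A : finType) (a0 : A) (P : {set T}) (c : A -> nat) :
  \sum_a c a = #|P| ->
  exists f : T -> A, forall a, #|[set t in P | f t == a]| = c a.
Proof.
move=> sum_c.
pose L := flatten [seq nseq (c a) a | a <- enum A].
have sizeL : size L = #|P|.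
  rewrite size_flatten /shape -map_comp sumnE big_map big_enum -sum_c /=.
  by apply: eq_bigr => a _; rewrite size_nseq.
pose f t := nth a0 L (index t (enum P)).
have defL : L = map f (enum P).
  apply: (@eq_from_nth _ a0) => [|i ltiL]; first by rewrite size_map sizeL cardE.
  have ltiP : i < size (enum P) by rewrite -cardE -sizeL.
  (* [nth_map] needs a default element of [T]; one exists because [i] is an index into [enum P]. *)
  have [t0 _] : exists t0, t0 \in enum P.
    by move: ltiP; case: (enum P) => // t0 s _; exists t0; rewrite mem_head.
  by rewrite (nth_map t0) // /f index_uniq ?enum_uniq.
exists f => a; transitivity (count_mem a L).
  rewrite defL count_map cardE -size_filter; congr (size _).
  by rewrite /enum_mem -filter_predI; apply: eq_filter => t; rewrite /= !inE andbC.
rewrite count_flatten -map_comp sumnE big_map big_enum /= (bigD1 a) //=.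
rewrite count_nseq /= eqxx mul1n big1 ?addn0 // => b /negbTE neqba.
by rewrite count_nseq /= neqba.
Qed.

Lemma size_prefix N M (s : bits N) : M <= N -> size (take M s) = M.
Proof. by move=> leMN; rewrite size_takel ?size_tuple. Qed.

(** [insubd] makes the truncation a total map into [bits M]; the all-false default is reached only
    when [M > N]. *)
Definition prefix M N (s : bits N) : bits M := insubd [tuple of nseq M false] (take M s).

Lemma val_prefix M N (s : bits N) : M <= N -> prefix M s = take M s :> seq bool.
Proof. by move=> leMN; rewrite /prefix insubdK // unfold_in size_prefix. Qed.

(** [Q] is a predicate on plain sequences so that it applies both to [x] and to [take M (pi s)]. *)
Lemma sum_prefix_count N M (pi : {perm bits N}) (Q : pred (seq bool)) k : M <= N ->
  \sum_(x : bits M | Q x) prefix_count pi x k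
  = #|[set s : bits N | (hweight s == k) && Q (take M (pi s))]|.
Proof.
move=> leMN; rewrite -sum1_card.
rewrite (partition_big (fun s => prefix M (pi s)) (fun x => Q x)) /=; last first.
  by move=> s; rewrite inE val_prefix // => /andP[].
apply: eq_bigr => x Qx; rewrite /prefix_count -sum1_card.
apply: eq_bigl => s; rewrite !inE -val_eqE /= val_prefix // -andbA; congr (_ && _).
by case: eqP => [->|]; rewrite ?Qx ?andbT ?andbF.
Qed.

Lemma card_prefix N M (x : bits M) : M <= N ->
  #|[set s : bits N | prefix M s == x]| = 2 ^ (N - M).
Proof.
move=> leMN.
pose F (y : bits (N - M)) : bits N := tcast (subnKC leMN) [tuple of x ++ y].
have valF y : F y = x ++ y :> seq bool by rewrite val_tcast.
have Finj : injective F.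
  move=> y z /(congr1 (@tval _ _)); rewrite !valF => /eqP.
  by rewrite eqseq_cat // eqxx /= => /eqP/val_inj.
rewrite -[2](card_bool) -card_tuple -cardsT -(card_imset _ Finj).
apply: eq_card => s; rewrite !inE; apply/eqP/imsetP => [defx|[y _ ->]].
  have sz : size (drop M s) == N - M by rewrite size_drop size_tuple.
  exists (Tuple sz) => //; apply: val_inj.
  by rewrite /= valF /= -defx val_prefix // cat_take_drop.
apply: val_inj; rewrite /= val_prefix // valF take_size_cat //.
by rewrite size_tuple.
Qed.

(** Each shell is labelled by prefixes with the prescribed counts. Over all shells a label then
    occurs [2 ^ (N - M)] times, which is the size of a fibre of [prefix], so [perm_of_fibres] turns
    labels into actual prefixes. *)
Lemma perm_of_prefix_counts N M (n : bits M -> nat -> nat) : M <= N ->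
  (forall k, k <= N -> \sum_x n x k = 'C(N, k)) ->
  (forall x, \sum_(k < N.+1) n x k = 2 ^ (N - M)) ->
  exists pi : {perm bits N}, forall x k, k <= N -> prefix_count pi x k = n x k.
Proof.
move=> leMN sum_x sum_k.
pose shell k := [set s : bits N | hweight s == k].
have /fin_all_exists[f fP] (k : 'I_N.+1) : exists f : bits N -> bits M,
    forall x, #|[set s in shell k | f s == x]| = n x k.
  apply: labelling_of_counts => [|]; first exact: [tuple of nseq M false].
  by rewrite card_hweight sum_x // -ltnS.
pose g (s : bits N) := f (inord (hweight s)) s.
have gP x k : k <= N -> #|[set s in shell k | g s == x]| = n x k.
  move=> lekN; have lt_k : k < N.+1 by [].
  rewrite -(fP (Ordinal lt_k)); apply: eq_card => s; rewrite !inE.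
  case: eqP => //= hk; congr (f _ _ == _).
  by apply: val_inj; rewrite /= inordK hk.
have [|pi piP] := @perm_of_fibres _ _ g (@prefix M N).
  move=> x; rewrite card_prefix // -(sum_k x) -sum1_card.
  rewrite (partition_big (fun s : bits N => inord (hweight s) : 'I_N.+1) xpredT) //=.
  apply: eq_bigr => k _; have lekN : k <= N by rewrite -ltnS.
  rewrite -gP // -sum1_card.
  apply: eq_bigl => s; rewrite !inE andbC; congr (_ && _).
  by rewrite -val_eqE /= inordK // ltnS hweight_leq.
exists pi => x k lekN; rewrite -gP //; apply: eq_card => s; rewrite !inE.
by rewrite -piP -val_eqE /= val_prefix.
Qed.

(** * Balanced permutations *)

(** The sum counts the ones on target positions over the images of shell [k]. Counted position by
    position, balance makes it [M] equal terms. *)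
Lemma dvd_weighted_passive N M (pi : {perm bits N}) k :
    0 < M -> M <= N -> k <= N -> optimal_perm M pi -> shellwise_balanced M pi ->
  M %| \sum_(w < M.+1) w * passive_mult N M w k.
Proof.
case: M => // M _ leMN lekN opt bal.
have -> : \sum_(w < M.+2) w * passive_mult N M.+1 w k
    = \sum_(x : bits M.+1) hweight x * prefix_count pi x k.
  rewrite (partition_big (fun x : bits M.+1 => inord (hweight x) : 'I_M.+2) xpredT) //=.
  apply: eq_bigr => w _; have lewM : w <= M.+1 by rewrite -ltnS.
  rewrite -opt // -(sum_prefix_count pi (fun x => hweight x == w)) // big_distrr /=.
  have eqw (x : bits M.+1) : (inord (hweight x) == w) = (hweight x == w).
    by rewrite -val_eqE /= inordK // ltnS hweight_leq.
  by apply: eq_big => [x|x /eqP ->]; rewrite ?eqw.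
rewrite (eq_bigr (fun x : bits M.+1 => \sum_(i < M.+1) tnth x i * prefix_count pi x k)) => [|x _].
  rewrite exchange_big /=.
  rewrite (eq_bigr (fun i => \sum_(x : bits M.+1) tnth x ord0 * prefix_count pi x k)).
    by rewrite sum_nat_const card_ord dvdn_mulr.
  by move=> i _; apply: bal.
by rewrite hweight_sum big_distrl.
Qed.

(** The total target weight of the first [p] positions of the passive filling. *)
Definition sector_excess N M p := \sum_(w < M.+1) w * sector_part N M w p.

Lemma dvd_sector_excess N M (pi : {perm bits N}) k :
    0 < M -> M <= N -> k <= N.+1 -> optimal_perm M pi -> shellwise_balanced M pi ->
  M %| sector_excess N M (cumB N k).
Proof.
move=> M_gt0 leMN lekN opt bal; rewrite /sector_excess.
under eq_bigr do rewrite -sum_passive_shells big_distrr /=.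
rewrite exchange_big /=; apply: dvdn_sum => j _.
by apply: dvd_weighted_passive opt bal => //; rewrite -ltnS (leq_trans (ltn_ord j)).
Qed.

Lemma optimal_of_prefix_counts N M (pi : {perm bits N}) : M <= N ->
  (forall w k, w <= M -> k <= N ->
     \sum_(x : bits M | hweight x == w) prefix_count pi x k = passive_mult N M w k) ->
  optimal_perm M pi.
Proof.
move=> leMN sum_w w k lewM lekN; rewrite -sum_w //.
by rewrite (sum_prefix_count pi (fun x => hweight x == w)).
Qed.

Lemma hweight_permute n (p : {perm 'I_n}) (x : bits n) :
  hweight [tuple tnth x (p i) | i < n] = hweight x.
Proof.
rewrite !hweight_sum [RHS](reindex_inj (@perm_inj _ p)).
by apply: eq_bigr => i _; rewrite tnth_mktuple.
Qed.

(** Exchanging the bits [i] and [j] is a weight-preserving involution on prefixes, and it carries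
    one marginal sum to the other. *)
Lemma balanced_of_hamming_symmetric N M (pi : {perm bits N}) :
  hamming_symmetric M pi -> shellwise_balanced M pi.
Proof.
move=> sym i j k lekN; pose p := tperm i j.
pose P (x : bits M) := [tuple tnth x (p l) | l < M].
have PK : involutive P.
  by move=> x; apply: eq_from_tnth => l; rewrite !tnth_mktuple tpermK.
rewrite (reindex_inj (inv_inj PK)); apply: eq_bigr => x _.
rewrite tnth_mktuple tpermL; congr (_ * _).
exact/sym/hweight_permute.
Qed.

(** Each [passive_mult N M w k] is shared equally among the ['C(M, w)] prefixes of weight [w].
    Summing over [k] gives every prefix the required total [2 ^ (N - M)]. *)
Lemma hamming_symmetric_exists N M : M <= N -> hamming_divisible N M ->
  exists pi : {perm bits N}, optimal_perm M pi /\ hamming_symmetric M pi.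
Proof.
move=> leMN divH.
pose n (x : bits M) k := passive_mult N M (hweight x) k %/ 'C(M, hweight x).
have sum_n w k : w <= M -> k <= N ->
    \sum_(x : bits M | hweight x == w) n x k = passive_mult N M w k.
  move=> lewM lekN; rewrite (eq_bigr (fun=> passive_mult N M w k %/ 'C(M, w))).
    rewrite sum_nat_const -(card_hweight M w) cardsE -[RHS](divnK (divH w k lewM lekN)).
    by rewrite -(card_hweight M w) cardsE mulnC.
  by move=> x /eqP; rewrite /n => ->.
have [k lekN|x|pi piP] := perm_of_prefix_counts (n := n) leMN.
- rewrite (partition_big (fun x : bits M => inord (hweight x) : 'I_M.+1) xpredT) //=.
  rewrite -(sum_passive_sectors leMN lekN); apply: eq_bigr => w _.
  have lewM : w <= M by rewrite -ltnS.
  rewrite -sum_n //; apply: eq_bigl => x.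
  by rewrite -val_eqE /= inordK // ltnS hweight_leq.
- have C_gt0 : 0 < 'C(M, hweight x) by rewrite bin_gt0 hweight_leq.
  apply/eqP; rewrite -(eqn_pmul2r C_gt0) -(sum_passive_shells_full leMN (hweight_leq x)).
  rewrite big_distrl; apply/eqP; apply: eq_bigr => k _.
  have lekN : k <= N by rewrite -ltnS.
  by rewrite /n /= divnK // divH ?hweight_leq.
exists pi; split.
  apply: optimal_of_prefix_counts => // w k lewM lekN; rewrite -sum_n //.
  by apply: eq_bigr => x _; rewrite piP.
by move=> x y k lekN eqxy; rewrite !piP // /n eqxy.
Qed.

Lemma hamming_divisible_of_symmetric N M (pi : {perm bits N}) : M <= N ->
  optimal_perm M pi -> hamming_symmetric M pi -> hamming_divisible N M.
Proof.
move=> leMN opt sym w k lewM lekN; rewrite -opt //.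
rewrite -(sum_prefix_count pi (fun x => hweight x == w)) //.
case: (pickP (fun x : bits M => hweight x == w)) => [x0 /eqP hx0|no_x]; last first.
  by rewrite big_pred0.
rewrite (eq_bigr (fun=> prefix_count pi x0 k)) => [|x /eqP hx].
  by rewrite sum_nat_const -(card_hweight M w) cardsE dvdn_mulr.
by apply: sym; rewrite // hx hx0.
Qed.

(** * Balanced blocks and their distribution over the shells *)

Definition balanced_block M (s : seq (bits M)) :=
  forall i j : 'I_M, \sum_(x <- s) tnth x i = \sum_(x <- s) tnth x j.

Lemma balanced_flatten M (ss : seq (seq (bits M))) :
  (forall s, s \in ss -> balanced_block s) -> balanced_block (flatten ss).
Proof.
move=> bal i j; rewrite !big_flatten /=; apply: eq_big_seq => s /bal; exact.
Qed.

Lemma sum_count_mem (T : finType) (F : T -> nat) s :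
  \sum_x F x * count_mem x s = \sum_(x <- s) F x.
Proof.
elim: s => [|y s IHs]; first by rewrite big_nil big1 // => x; rewrite muln0.
rewrite big_cons -IHs /= (bigD1 y) // [X in _ = _ + X](bigD1 y) //= eqxx mulnDr.
rewrite muln1 addnA; congr (_ + _); apply: eq_bigr => x /negbTE neqxy.
by rewrite eq_sym neqxy.
Qed.

Lemma size_flatten_uniform (T : eqType) b (ss : seq (seq T)) :
  {in ss, forall s, size s = b} -> size (flatten ss) = size ss * b.
Proof.
move=> size_ss; rewrite size_flatten /shape sumnE big_map.
by rewrite (eq_big_seq (fun=> b)) // big_const_seq count_predT iter_addn_0 mulnC.
Qed.

(** The list of blocks is cut by [reshape] into consecutive runs of [c k %/ b] blocks; the
    hypothesis on the sum says that the runs exhaust the list. *)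
Lemma distribute_blocks (T : eqType) b (ss : seq (seq T)) (c : nat -> nat) n :
    0 < b -> {in ss, forall s, size s = b} -> (forall k, k < n -> b %| c k) ->
    \sum_(k < n) c k = size (flatten ss) ->
  exists f : nat -> seq (seq T),
    [/\ forall k, k < n -> size (flatten (f k)) = c k,
        forall k, {subset f k <= ss} &
        forall x, \sum_(k < n) count_mem x (flatten (f k)) = count_mem x (flatten ss)].
Proof.
move=> b_gt0 size_ss div_c sum_c.
pose m := mkseq (fun k => c k %/ b) n.
have sum_m : sumn m = size ss.
  apply/eqP; rewrite -(eqn_pmul2r b_gt0) -size_flatten_uniform // -sum_c.
  rewrite sumnE big_map big_distrl /= -(subn0 n) -/(index_iota 0 n) big_mkord subn0.
  by apply/eqP/eq_bigr => k _; rewrite divnK ?div_c.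
pose f k := nth [::] (reshape m ss) k.
have f_ss k : {subset f k <= ss} by move=> s; rewrite /f nth_reshape => /mem_take/mem_drop.
exists f; split=> // [k ltkn|x].
  rewrite (@size_flatten_uniform _ b); last by move=> s /f_ss/size_ss.
  suff -> : size (f k) = c k %/ b by rewrite divnK ?div_c.
  rewrite /f -(nth_map _ 0) ?size_reshape ?size_mkseq // -/(shape _).
  by rewrite reshapeKl ?sum_m // nth_mkseq.
rewrite -[in RHS](@reshapeKr _ m ss) ?sum_m // [in RHS]count_flatten sumnE big_map.
rewrite big_flatten /= (big_nth [::]) size_reshape size_mkseq big_mkord.
by apply: eq_bigr => k _; rewrite count_flatten sumnE big_map.
Qed.

(** For each [w], [2 ^ (N - M)] copies of the partition [ss w] are dealt out to the shells, and
    [n x k] counts the occurrences of [x] in the blocks given to shell [k]. Whole blocks keep every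
    shell balanced, and the number of copies gives the prefix totals. *)
Lemma balanced_exists N M (b : nat -> nat) (ss : nat -> seq (seq (bits M))) :
    M <= N ->
    (forall w, w <= M -> 0 < b w) ->
    (forall w, w <= M -> {in ss w, forall s, size s = b w /\ balanced_block s}) ->
    (forall w x, w <= M -> count_mem x (flatten (ss w)) = (hweight x == w)) ->
    (forall w k, w <= M -> k <= N -> b w %| passive_mult N M w k) ->
  exists pi : {perm bits N}, optimal_perm M pi /\ shellwise_balanced M pi.
Proof.
move=> leMN b_gt0 ssP ss_count div_c.
have size_ss w : w <= M -> size (flatten (ss w)) = 'C(M, w).
  move=> lewM; rewrite -(card_hweight M w) -sum1_card -sum1_size.
  rewrite -(sum_count_mem (fun=> 1)) [RHS]big_mkcond /=.
  by apply: eq_bigr => x _; rewrite mul1n ss_count // inE; case: eqP.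
pose D := 2 ^ (N - M).
have count_D w x : w <= M ->
    count_mem x (flatten (flatten (nseq D (ss w)))) = D * (hweight x == w).
  move=> lewM; rewrite -ss_count //; elim: D => // d IHd.
  by rewrite /= flatten_cat count_cat IHd mulSn.
have ssD w : {subset flatten (nseq D (ss w)) <= ss w}.
  by move=> s /flattenP[t] /nseqP[->].
have /fin_all_exists[f fP] (w : 'I_M.+1) : exists f : nat -> seq (seq (bits M)),
    [/\ forall k, k < N.+1 -> size (flatten (f k)) = passive_mult N M w k,
        forall k, {subset f k <= ss w} &
        forall x, \sum_(k < N.+1) count_mem x (flatten (f k)) = D * (hweight x == w)].
  have lewM : w <= M by rewrite -ltnS.
  have [||||f [f_size f_ss f_count]] := @distribute_blocks _ (b w)
    (flatten (nseq D (ss w))) (passive_mult N M w) N.+1.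
  - exact: b_gt0.
  - by move=> s /ssD /ssP[].
  - by move=> k ltkN; rewrite div_c.
  - rewrite sum_passive_shells_full // -(size_ss w) // -/D.
    by elim: (D) => // d IHd; rewrite /= !flatten_cat size_cat -IHd mulSn.
  exists f; split=> // [k s /f_ss/ssD //|x]; by rewrite f_count count_D.
(* By [count_f], only the term with [w = hweight x] can be nonzero. *)
pose n (x : bits M) k := \sum_(w < M.+1) count_mem x (flatten (f w k)).
have fw (w : 'I_M.+1) k (x : bits M) : x \in flatten (f w k) -> hweight x = w.
  have lewM : w <= M by rewrite -ltnS.
  move=> x_f; apply/eqP; rewrite -[_ == _]lt0b -ss_count // -has_count has_pred1.
  case/flattenP: x_f => s; have [_ f_ss _] := fP w => /f_ss s_ss x_s.
  by apply/flattenP; exists s.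
have count_f (w : 'I_M.+1) k (x : bits M) : hweight x != w -> count_mem x (flatten (f w k)) = 0.
  by move=> neq_w; apply/count_memPn; apply: contra neq_w => /fw ->.
have sum_n (w : 'I_M.+1) k : k <= N ->
    \sum_(x : bits M | hweight x == w) n x k = passive_mult N M w k.
  move=> lekN; have [<- // _ _] := fP w; rewrite -sum1_size -(sum_count_mem (fun=> 1)).
  rewrite big_mkcond; apply: eq_bigr => x _; rewrite mul1n.
  case: eqP => [hx|/eqP/count_f -> //].
  rewrite /n (bigD1 w) //= big1 ?addn0 // => v neq_vw; apply: count_f.
  by rewrite hx eq_sym.
have [k lekN|x|pi piP] := perm_of_prefix_counts (n := n) leMN.
- rewrite (partition_big (fun x : bits M => inord (hweight x) : 'I_M.+1) xpredT) //=.
  rewrite -(sum_passive_sectors leMN lekN); apply: eq_bigr => w _.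
  rewrite -sum_n //; apply: eq_bigl => x.
  by rewrite -val_eqE /= inordK // ltnS hweight_leq.
- transitivity (\sum_(w < M.+1) D * (hweight x == w)).
    by rewrite exchange_big; apply: eq_bigr => w _; have [_ _] := fP w; apply.
  have ltxM : hweight x < M.+1 by rewrite ltnS hweight_leq.
  rewrite (bigD1 (Ordinal ltxM)) //= eqxx muln1 big1 ?addn0 // => w.
  by rewrite -val_eqE eq_sym /= => /negbTE ->; rewrite muln0.
exists pi; split.
  apply: optimal_of_prefix_counts => // w k lewM lekN.
  have ltwM : w < M.+1 by [].
  rewrite -(sum_n (Ordinal ltwM)) //.
  by apply: eq_bigr => x _; rewrite piP.
move=> i j k lekN.
(* Turns the marginal of shell [k] into a sum over the blocks it received, sector by sector. *)
have sum_i l : \sum_(x : bits M) tnth x l * prefix_count pi x k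
    = \sum_(w < M.+1) \sum_(x <- flatten (f w k)) tnth x l.
  under eq_bigr => x _ do rewrite piP // /n big_distrr /=.
  rewrite exchange_big /=; apply: eq_bigr => w _.
  exact: (sum_count_mem (fun x : bits M => tnth x l : nat)).
rewrite !sum_i; apply: eq_bigr => w _; apply: balanced_flatten => s.
have lewM : w <= M by rewrite -ltnS.
by have [_ f_ss _] := fP w => /f_ss/ssP[].
Qed.

(** After division by the gcd the two factors are coprime, and Gauss's lemma applies. *)
Lemma dvdn_div_gcd m w c : 0 < m -> m %| w * c -> m %/ gcdn m w %| c.
Proof.
move=> m_gt0 div_c; have g_gt0 : 0 < gcdn m w by rewrite gcdn_gt0 m_gt0.
have co : coprime (m %/ gcdn m w) (w %/ gcdn m w).
  rewrite /coprime -(eqn_pmul2r g_gt0) muln_gcdl mul1n.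
  by rewrite !divnK ?dvdn_gcdl ?dvdn_gcdr.
rewrite -(Gauss_dvdr _ co) -(dvdn_pmul2r g_gt0) mulnAC.
by rewrite !divnK ?dvdn_gcdl ?dvdn_gcdr.
Qed.

(** * Balanced blocks for small M *)

Fixpoint bitstrings n : seq (seq bool) :=
  if n is m.+1 then map (cons false) (bitstrings m) ++ map (cons true) (bitstrings m)
  else [:: [::]].

Fixpoint lexleq (s t : seq bool) : bool :=
  match s, t with
  | a :: s', b :: t' => if a then if b then lexleq s' t' else false
                        else if b then true else lexleq s' t'
  | _, _ => true
  end.

(* The circle method: a 1-factorization of the complete graph on M vertices. *)
Definition circle_rounds M : seq (seq (seq bool)) :=
  let edge a b := mkseq (fun p => (p == a) || (p == b)) M in
  let n := M.-1 in
  [seq edge n i :: [seq edge ((i + j) %% n) ((i + n - j) %% n) | j <- iota 1 (n./2)]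
  | i <- iota 0 n].

(** For [0 < w < M] this is the least possible size: [b] strings carry [b * w] ones, which balance
    spreads evenly over [M] positions. *)
Definition block_size M w := if (w == 0) || (w == M) then 1 else M %/ gcdn M w.

(* For gcd(M, w) = 1 the blocks are the orbits of the rotation, each listed from its
   lexicographically largest member; for 2w = M they are complementary pairs; the
   remaining cases met below are w = 2 and w = M - 2 for even M. *)
Definition blocks M w : seq (seq (seq bool)) :=
  let strings := [seq s <- bitstrings M | hweight s == w] in
  if (w == 0) || (w == M) then [:: strings]
  else if gcdn M w == 1 then
    [seq mkseq (fun i => rot i s) M | s <- strings & all (fun i => lexleq (rot i s) s) (iota 0 M)]
  else if w.*2 == M then [seq [:: s; map negb s] | s <- strings & head false s]
  else if w == 2 then circle_rounds M
  else map (map (map negb)) (circle_rounds M).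

Definition valid_block M w (s : seq (seq bool)) :=
  [&& size s == block_size M w,
      all (fun x => (size x == M) && (hweight x == w)) s &
      constant [seq count (fun x => nth false x i) s | i <- iota 0 M]].

(** Distinct strings of weight [w], ['C(M, w)] in number, necessarily form the whole sector, so
    these conditions express that the blocks partition it. *)
Definition valid_blocks M w :=
  [&& all (valid_block M w) (blocks M w), uniq (flatten (blocks M w))
    & size (flatten (blocks M w)) == 'C(M, w)].

(** These are the values of [M] that occur in [listed_asymmetric]. *)
Lemma valid_blocks_small :
  all (fun M => all (valid_blocks M) (iota 0 M.+1)) [:: 4; 5; 6; 7; 8; 11].
Proof. by vm_compute. Qed.

Lemma balanced_of_locally_balanced N M : M <= N -> M \in [:: 4; 5; 6; 7; 8; 11] ->
  locally_balanced N M ->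
  exists pi : {perm bits N}, optimal_perm M pi /\ shellwise_balanced M pi.
Proof.
move=> leMN inM lbal.
have valid w : w <= M -> valid_blocks M w.
  by move=> lewM; apply: (allP (allP valid_blocks_small M inM)); rewrite mem_iota.
(* The blocks are computed on plain sequences and transported to tuples; validity guarantees length
   [M], so the default never intervenes. *)
pose tup (x : seq bool) : bits M := insubd [tuple of nseq M false] x.
have tupK (x : seq bool) : size x == M -> tup x = x :> seq bool.
  by move=> sz; rewrite /tup insubdK.
pose ss w := map (map tup) (blocks M w).
have val_ss w : w <= M -> map val (flatten (ss w)) = flatten (blocks M w).
  move=> lewM; have /and3P[/allP blocksP _ _] := valid w lewM.
  rewrite map_flatten -map_comp; congr flatten; apply: map_id_in => s.
  case/blocksP/and3P=> _ /allP s_w _; rewrite /= -map_comp; apply: map_id_in => x.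
  by case/s_w/andP=> sz _; rewrite /= tupK.
apply: (balanced_exists (b := block_size M) (ss := ss)) => //.
- move=> w lewM; rewrite /block_size; case: ifP => // /norP[w_neq0 _].
  by rewrite divn_gt0 ?gcdn_gt0 ?lt0n ?w_neq0 ?orbT // dvdn_leq ?dvdn_gcdl //; lia.
- move=> w lewM s /mapP[t]; have /and3P[/allP blocksP _ _] := valid w lewM.
  case/blocksP/and3P=> /eqP sz /allP t_w bal ->; split; first by rewrite size_map.
  have sumE (i : 'I_M) : \sum_(x <- map tup t) tnth x i
      = nth 0 [seq count (fun x => nth false x i) t | i <- iota 0 M] i.
    rewrite (nth_map 0) ?size_iota // nth_iota // add0n -sum1_count big_map [RHS]big_mkcond.
    apply: eq_big_seq => x /t_w/andP[szx _].
    by rewrite (tnth_nth false) tupK //; case: nth.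
  move=> i j; rewrite !sumE; case/(constantP 0): bal => c ->.
  by rewrite !nth_nseq !size_map !size_iota !ltn_ord.
- move=> w x lewM; have /and3P[/allP blocksP uq /eqP sz] := valid w lewM.
  have uqs : uniq (flatten (ss w)) by rewrite -(map_inj_uniq val_inj) val_ss.
  rewrite count_uniq_mem //; congr nat_of_bool.
  have -> : (hweight x == w) = (x \in enum [set y : bits M | hweight y == w]).
    by rewrite mem_enum inE.
  (* A duplicate-free list included in the sector and of the same size has the same elements. *)
  suff [_ -> //] : (size (flatten (ss w)) = size (enum [set y : bits M | hweight y == w]))
      * (flatten (ss w) =i enum [set y : bits M | hweight y == w]).
  apply: (uniq_min_size uqs) => [y y_ss|].
    rewrite mem_enum inE; have : val y \in flatten (blocks M w).
      by rewrite -val_ss // map_f.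
    by case/flattenP=> s /blocksP/and3P[_ /allP s_w _] /s_w/andP[].
  by rewrite -cardE card_hweight -sz -val_ss // size_map.
- move=> w k lewM lekN; rewrite /block_size; case: ifP => [_|/norP[w_neq0 w_neqM]].
    exact: dvd1n.
  have w_gt0 : 0 < w by rewrite lt0n.
  have ltwM : w < M by rewrite ltn_neqAle w_neqM.
  apply: dvdn_div_gcd; first exact: leq_trans ltwM.
  by apply: lbal => //; lia.
Qed.

(** * Reduced states *)

Section Marginals.
Import Order.TTheory GRing.Theory Num.Theory.
Local Open Scope ring_scope.
Local Open Scope complex_scope.
Variable R : realType.

Lemma entry_ketbra (T : finType) (a b s t : T) :
  entry (ketbra R a b) s t = ((s == a) && (t == b))%:R.
Proof. by rewrite /entry mxE !(inj_eq enum_rank_inj). Qed.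

Lemma entry_of_entries (T : finType) (f : T -> T -> R[i]) s t :
  entry (of_entries f) s t = f s t.
Proof. by rewrite /entry mxE !enum_rankK. Qed.

Lemma entry_inj (T : finType) (A B : 'M[R[i]]_#|{: T}|) :
  (forall s t : T, entry A s t = entry B s t) -> A = B.
Proof.
move=> eqAB; apply/matrixP => i j.
by have := eqAB (enum_val i) (enum_val j); rewrite /entry !enum_valK.
Qed.

Lemma entry_mulmx (T : finType) (A B : 'M[R[i]]_#|{: T}|) s t :
  entry (A *m B) s t = \sum_(u : T) entry A s u * entry B u t.
Proof.
rewrite /entry mxE (reindex (@enum_rank T)) //=.
exact: onW_bij (enum_rank_bij T).
Qed.

(** The eigenvalue [q_k] for [k = hweight s]. *)
Definition thermal_weight N (P1 : R) (s : bits N) : R :=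
  (1 - P1) ^+ (N - hweight s) * P1 ^+ hweight s.

Lemma prod_thermal_weight N (P1 : R) (s : bits N) :
  \prod_(l < N) (if tnth s l then P1 else 1 - P1) = thermal_weight P1 s.
Proof.
rewrite -(big_tuple _ _ s xpredT (fun b => if b then P1 else 1 - P1)) /thermal_weight.
have -> : (N - hweight s = count_mem false s)%N.
  transitivity (size s - hweight s)%N; first by rewrite size_tuple.
  rewrite -(count_predC (pred1 true) s) addKn.
  by apply: eq_count => -[].
rewrite /hweight; elim: (val s) => [|b r IHr]; first by rewrite big_nil mulr1.
rewrite big_cons IHr /=; case: b => /=; first by rewrite add0n add1n exprS mulrCA.
by rewrite add0n add1n exprS mulrA.
Qed.

Lemma entry_thermal_state N (P1 : R) (s t : bits N) :
  entry (thermal_state N P1) s t = ((s == t)%:R * thermal_weight P1 s)%:C.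
Proof.
rewrite entry_of_entries.
have entryE a b : entry (thermal_qubit P1) a b
    = ((a == b)%:R * (if a then P1 else 1 - P1))%:C.
  rewrite /entry !mxE -!/(entry _ _ _) !(inj_eq enum_rank_inj).
  by case: a; case: b; rewrite /= ?mulr0 ?mulr1 ?mul0r ?mul1r ?addr0 ?add0r.
under eq_bigr => l _ do rewrite entryE.
rewrite -rmorph_prod big_split /= prod_thermal_weight; congr (_ * _)%:C.
case: eqP => [->|neq]; first by rewrite big1 // => l _; rewrite eqxx.
(* Distinct strings differ at some qubit [l], whose factor vanishes: the thermal state is
   diagonal. *)
have [l neql] : exists l, tnth s l != tnth t l.
  apply/existsP; rewrite -negb_forall; apply/forallP => eqst.
  by apply: neq; apply: eq_from_tnth => l; apply/eqP.
by rewrite (bigD1 l) //= (negbTE neql) mul0r.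
Qed.

Lemma entry_perm_unitary N (pi : {perm bits N}) (s t : bits N) :
  entry (perm_unitary R pi) s t = (s == pi t)%:R.
Proof.
rewrite /entry summxE (bigD1 t) //= big1 ?addr0 => [|b neqb].
  by rewrite -/(entry _ _ _) entry_ketbra eqxx andbT.
by rewrite -/(entry _ _ _) entry_ketbra [t == b]eq_sym (negbTE neqb) andbF.
Qed.

Lemma entry_adjoint (T : finType) (A : 'M[R[i]]_#|{: T}|) s t :
  entry (adjoint A) s t = (entry A t s)^*%R.
Proof. by rewrite /entry !mxE. Qed.

(** Conjugation by the permutation matrix relabels the basis; evaluating at [pi s] and [pi t] avoids
    the inverse permutation. *)
Lemma entry_evolved_state N (pi : {perm bits N}) (P1 : R) (s t : bits N) :
  entry (evolved_state pi P1) (pi s) (pi t) = entry (thermal_state N P1) s t.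
Proof.
rewrite /evolved_state entry_mulmx (bigD1 t) //= [X in _ + X]big1 ?addr0 => [|u neqt]; last first.
  rewrite entry_adjoint entry_perm_unitary (inj_eq perm_inj).
  by rewrite eq_sym (negbTE neqt) conjC0 mulr0.
rewrite entry_adjoint entry_perm_unitary eqxx conjC1 mulr1.
rewrite entry_mulmx (bigD1 s) //= [X in _ + X]big1 ?addr0 => [|u neqs]; last first.
  by rewrite entry_perm_unitary (inj_eq perm_inj) eq_sym (negbTE neqs) mul0r.
by rewrite entry_perm_unitary eqxx mul1r.
Qed.

Lemma entry_reduced_state N (pi : {perm bits N}) (P1 : R) (i : 'I_N) a b :
  entry (reduced_state i (evolved_state pi P1)) a b
  = ((a == b)%:R * \sum_(s : bits N | tnth (pi s) i == a) thermal_weight P1 s)%:C.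
Proof.
rewrite entry_of_entries (reindex_inj (@perm_inj _ pi)) /=.
rewrite rmorphM rmorph_sum big_distrr /=; apply: eq_bigr => s /eqP si.
rewrite (reindex_inj (@perm_inj _ pi)) /=.
under eq_bigr => t _ do rewrite entry_evolved_state entry_thermal_state.
(* Only [t = s] contributes, since the thermal state is diagonal. This is impossible when the bits
   [a] and [b] at position [i] differ. *)
case: eqP => [<-|neqab].
  rewrite (bigD1 s) /=; last by rewrite si eqxx; apply/forallP => l; rewrite eqxx implybT.
  rewrite eqxx mul1r big1 ?addr0 ?mul1r // => t /andP[_ neqt].
  by rewrite eq_sym (negbTE neqt) mul0r.
rewrite mul0r big1 // => t /andP[/eqP ti _].
by case: eqP => [eqst|_]; [case: neqab; rewrite -si -ti eqst | rewrite mul0r].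
Qed.

(** The number written [m_{i,k}] above. *)
Definition shell_marginal N (pi : {perm bits N}) (i : 'I_N) k : nat :=
  #|[set s : bits N | (hweight s == k) && tnth (pi s) i]|.

Lemma sum_thermal_weight N (pi : {perm bits N}) (P1 : R) (i : 'I_N) :
  \sum_(s : bits N | tnth (pi s) i == true) thermal_weight P1 s
  = \sum_(k < N.+1) (1 - P1) ^+ (N - k) * P1 ^+ k *+ shell_marginal pi i k.
Proof.
rewrite (partition_big (fun s : bits N => inord (hweight s) : 'I_N.+1) xpredT) //=.
apply: eq_bigr => k _; rewrite /shell_marginal -sumr_const.
have hk (s : bits N) : (inord (hweight s) == k) = (hweight s == k).
  by rewrite -val_eqE /= inordK // ltnS hweight_leq.
apply: eq_big => [s|s /andP[_]]; first by rewrite inE hk eqb_id andbC.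
by rewrite hk /thermal_weight => /eqP ->.
Qed.

(** Divided by [(1 - p) ^+ N], the sum becomes a polynomial of degree at most [N] in [p / (1 - p)];
    it has too many roots unless all coefficients vanish. *)
Lemma homogeneous_eq0 N (d : nat -> R) :
  (forall p, 0 < p < 2^-1 -> \sum_(k < N.+1) (1 - p) ^+ (N - k) * p ^+ k * d k = 0) ->
  forall k, (k <= N)%N -> d k = 0.
Proof.
move=> sum0 k lekN; pose P := \poly_(k < N.+1) d k.
suff /(congr1 (fun p : {poly R} => p`_k)) : P = 0 by rewrite coef_poly ltnS lekN coef0.
apply/eqP/contraT => P_neq0.
(* The [N + 1] distinct roots [1 / (n + 2)] are the ratios [p / (1 - p)] for [p = 1 / (n + 3)],
   which lies below [1 / 2]. *)
pose rs : seq R := mkseq (fun n => n.+2%:R^-1) N.+1.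
have uniq_rs : uniq rs.
  rewrite mkseq_uniq // => m n /invr_inj/eqP; rewrite eqr_nat => /eqP.
  by do 2![move/succn_inj].
suff roots_rs : all (root P) rs.
  by have := max_poly_roots P_neq0 roots_rs uniq_rs; rewrite size_mkseq ltnNge size_poly.
apply/allP => t /mapP[n _ ->]; rewrite /root horner_poly; apply/eqP.
pose p : R := n.+3%:R^-1.
have n3 : n.+3%:R != 0 :> R by rewrite pnatr_eq0.
have n2 : n.+2%:R != 0 :> R by rewrite pnatr_eq0.
have q_p : 1 - p = n.+2%:R / n.+3%:R.
  apply: (mulIf n3); rewrite mulrBl mul1r mulVf // divfK //.
  by rewrite -[n.+3]addn1 natrD addrK.
have q_neq0 : 1 - p != 0 by rewrite q_p mulf_neq0 ?invr_eq0.
have p_itv : 0 < p < 2^-1 by rewrite invr_gt0 ltr0n ltf_pV2 ?qualifE /= ?ltr0n ?ltr_nat.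
apply: (mulfI (expf_neq0 N q_neq0)); rewrite mulr0 -[RHS](sum0 p p_itv) big_distrr /=.
apply: eq_bigr => j _; have lejN : (j <= N)%N by rewrite -ltnS.
rewrite -{1}(subnK lejN) exprD [d j * _]mulrC !mulrA; congr (_ * _).
rewrite -mulrA -exprMn q_p; congr (_ * _ ^+ _).
by rewrite mulrAC mulfV // mul1r.
Qed.

Lemma shell_marginal_prefix N M (pi : {perm bits N}) (i : 'I_M) (leMN : (M <= N)%N) k :
  (\sum_(x : bits M) tnth x i * prefix_count pi x k)%N
  = shell_marginal pi (widen_ord leMN i) k.
Proof.
rewrite /shell_marginal.
rewrite (eq_bigr (fun x : bits M => if nth false x i then prefix_count pi x k else 0%N)).
  rewrite -big_mkcond (sum_prefix_count pi (fun x => nth false x i)) //.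
  apply: eq_card => s; rewrite !inE; congr (_ && _).
  by rewrite nth_take // (tnth_nth false).
by move=> x _; rewrite (tnth_nth false); case: nth; rewrite ?mul1n ?mul0n.
Qed.

(** Reduced states are diagonal with fixed trace, so comparing them means comparing the [true]
    entries, and [homogeneous_eq0] separates these by shells. *)
Lemma identical_marginals_balanced N M (pi : {perm bits N}) : (M <= N)%N ->
  identical_marginals R M pi <-> shellwise_balanced M pi.
Proof.
move=> leMN; split=> [same i j k lekN | bal P1 P1_itv i j ltiM ltjM].
  rewrite !(shell_marginal_prefix pi _ leMN).
  set a := widen_ord leMN i; set b := widen_ord leMN j.
  apply/eqP; rewrite -(eqr_nat R) -subr_eq0; apply/eqP.
  pose d l : R := (shell_marginal pi a l)%:R - (shell_marginal pi b l)%:R.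
  apply: (@homogeneous_eq0 N d) lekN => p p_itv.
  have /(congr1 (fun A => entry A true true)) := same p p_itv a b (ltn_ord i) (ltn_ord j).
  rewrite !entry_reduced_state eqxx !mul1r => /complexI.
  rewrite !sum_thermal_weight => /eqP; rewrite -subr_eq0 -sumrB => /eqP eq0.
  rewrite -[RHS]eq0; apply: eq_bigr => l _.
  by rewrite /d mulrBr !mulr_natr.
have eq_true : \sum_(s : bits N | tnth (pi s) i == true) thermal_weight P1 s
    = \sum_(s : bits N | tnth (pi s) j == true) thermal_weight P1 s.
  rewrite !sum_thermal_weight; apply: eq_bigr => k _; congr (_ *+ _).
  have lekN : (k <= N)%N by rewrite -ltnS.
  have := bal (Ordinal ltiM) (Ordinal ltjM) k lekN; rewrite !(shell_marginal_prefix pi _ leMN).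
  by congr (_ = _); congr (shell_marginal pi _ k); apply: val_inj.
apply: entry_inj => a b; rewrite !entry_reduced_state; congr (_ * _)%:C.
case: a => //; have split_sum l : \sum_(s : bits N | tnth (pi s) l == false) thermal_weight P1 s
    = \sum_(s : bits N) thermal_weight P1 s
      - \sum_(s : bits N | tnth (pi s) l == true) thermal_weight P1 s.
  rewrite [X in _ = X - _](bigID (fun s : bits N => tnth (pi s) l == true)) /= addrC addrK.
  by apply: eq_bigl => s; case: (tnth (pi s) l).
by rewrite !split_sum eq_true.
Qed.
End Marginals.

(** * Evaluation in binary arithmetic *)

Notation binN := BinNums.N.
Module BN := BinNat.N.

(** With [a] zero, this takes one row of Pascal's triangle to the next; [a] remembers the preceding
    entry of the old row. *)
Fixpoint pascal_step (a : binN) (r : seq binN) : seq binN :=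
  if r is b :: r' then BN.add a b :: pascal_step b r' else [:: a].

Fixpoint pascal_rows n (r : seq binN) : seq (seq binN) :=
  r :: (if n is m.+1 then pascal_rows m (pascal_step BN.zero r) else [::]).

Fixpoint partial_sums (a : binN) (r : seq binN) : seq binN :=
  if r is b :: r' then let c := BN.add a b in c :: partial_sums c r' else [::].

Definition pascal_table := pascal_rows 128 [:: BN.one].
Definition cum_table := map (partial_sums BN.zero) pascal_table.

(** The list [B_0, ..., B_N]: index [k] corresponds to [cumB N k.+1]. Likewise [sector_ends] lists
    [G_0, ..., G_M]. *)
Definition shell_ends N := nth [::] cum_table N.
Definition sector_ends N M :=
  map (BN.mul (BN.pow BN.two (BN.of_nat (N - M)))) (nth [::] cum_table M).

(** Evaluates [sector_excess]: [g] is the left end of the current sector, [w] its weight, and the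
    recursion stops once the sectors begin at or beyond [p]. *)
Fixpoint excess (p w g : binN) (gs : seq binN) : binN :=
  if gs is g' :: gs' then
    if BN.leb p g then BN.zero
    else BN.add (BN.mul w (BN.sub (BN.min p g') g)) (excess p (BN.succ w) g' gs')
  else BN.zero.

Fixpoint search_defect (m : binN) (gs ps : seq binN) : bool :=
  if ps is p :: ps' then
    if BN.eqb (BN.modulo (excess p BN.zero BN.zero gs) m) BN.zero
    then search_defect m gs ps' else true
  else false.

Definition unbalanced N M := search_defect (BN.of_nat M) (sector_ends N M) (shell_ends N).

(** Only the sector cut by [p] is tested: later sectors contribute 0, and earlier ones are full,
    with a size that the moduli in use divide. *)
Fixpoint sector_divisible (p g : binN) (gs ds : seq binN) : bool :=
  match gs, ds with
  | g' :: gs', d :: ds' =>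
    if BN.leb p g then true
    else if BN.leb g' p then sector_divisible p g' gs' ds'
    else BN.eqb (BN.modulo (BN.sub p g) d) BN.zero
  | _, _ => true
  end.

Definition divisible_check N M (ds : seq binN) :=
  let gs := sector_ends N M in
  all (fun p => sector_divisible p BN.zero gs ds) (shell_ends N).

Definition hamming_moduli M := nth [::] pascal_table M.
Definition local_moduli M := [seq BN.of_nat (M %/ gcdn M w) | w <- iota 0 M.+1].

(** The ranges are [4 <= N <= 128] and [2 <= M <= N - 2]; in [listed_check], [M] stops at 11, the
    largest listed value. *)
Definition unlisted_check :=
  all (fun N => all (fun M => if listed N M then true else unbalanced N M) (iota 2 (N - 3)))
    (iota 4 125).
Definition listed_check :=
  all (fun N => all (fun M => if listed N M then
      if listed_asymmetric N M then
        divisible_check N M (local_moduli M) && ~~ divisible_check N M (hamming_moduli M)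
      else divisible_check N M (hamming_moduli M) else true) (iota 2 10))
    (iota 4 125).

(** * Correctness of the binary evaluation *)

Lemma to_nat_leb p q : BN.leb p q = (BN.to_nat p <= BN.to_nat q).
Proof. by case: BN.leb_spec => le_pq; lia. Qed.

Lemma to_nat_add p q : BN.to_nat (BN.add p q) = BN.to_nat p + BN.to_nat q.
Proof. lia. Qed.

Lemma to_nat_excess_term p w g h : BN.to_nat (BN.mul w (BN.sub (BN.min p h) g))
  = BN.to_nat w * (minn (BN.to_nat p) (BN.to_nat h) - BN.to_nat g).
Proof. rewrite Nnat.N2Nat.inj_mul; congr (_ * _); lia. Qed.

Lemma modulo_eqb m p : 0 < BN.to_nat m ->
  BN.eqb (BN.modulo p m) BN.zero = (BN.to_nat m %| BN.to_nat p).
Proof.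
move=> m_gt0; have m_neq0 : m <> BN.zero by move=> m0; rewrite m0 in m_gt0.
apply/idP/idP => [/BN.eqb_eq mod0|/dvdnP[q def_p]].
  rewrite [p in X in _ %| X](BN.div_mod p m m_neq0) mod0 BN.add_0_r Nnat.N2Nat.inj_mul.
  exact: dvdn_mulr.
apply/BN.eqb_eq; have -> : p = BN.mul (BN.of_nat q) m.
  by apply: Nnat.N2Nat.inj; rewrite Nnat.N2Nat.inj_mul Nnat.Nat2N.id def_p.
exact: BN.Div0.mod_mul.
Qed.

Lemma nth_pascal_step a r k :
  BN.to_nat (nth BN.zero (pascal_step a r) k)
  = BN.to_nat (nth BN.zero (a :: r) k) + BN.to_nat (nth BN.zero r k).
Proof.
elim: r a k => [|b r IHr] a [|k] //=; rewrite ?to_nat_add ?IHr //.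
- by rewrite addn0.
- by rewrite !nth_nil.
Qed.

Lemma nth_pascal_rows n r i : i <= n ->
  nth [::] (pascal_rows n r) i = iter i (pascal_step BN.zero) r.
Proof. by elim: n r i => [|n IHn] r [|i] //= lein; rewrite IHn // -iterSr. Qed.

Lemma size_pascal_rows n r : size (pascal_rows n r) = n.+1.
Proof. by elim: n r => //= n IHn r; rewrite IHn. Qed.

Definition pascal_row n := iter n (pascal_step BN.zero) [:: BN.one].

Lemma size_pascal_row n : size (pascal_row n) = n.+1.
Proof.
have size_step a r : size (pascal_step a r) = (size r).+1.
  by elim: r a => //= b r IHr a; rewrite IHr.
by elim: n => //= n IHn; rewrite size_step IHn.
Qed.

Lemma nth_pascal_row n k : BN.to_nat (nth BN.zero (pascal_row n) k) = 'C(n, k).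
Proof.
elim: n k => [|n IHn] [|k] //=; first by rewrite nth_nil.
  by rewrite nth_pascal_step IHn !bin0.
by rewrite nth_pascal_step /= !IHn binS addnC.
Qed.

Lemma size_partial_sums a r : size (partial_sums a r) = size r.
Proof. by elim: r a => //= b r IHr a; rewrite IHr. Qed.

Lemma nth_partial_sums a r k : k < size r ->
  BN.to_nat (nth BN.zero (partial_sums a r) k)
  = BN.to_nat a + \sum_(j < k.+1) BN.to_nat (nth BN.zero r j).
Proof.
elim: r a k => // b r IHr a [|k] ltkr /=; rewrite big_ord_recl /=.
  by rewrite big_ord0 to_nat_add addn0.
by rewrite IHr // to_nat_add addnA.
Qed.

Lemma nth_pascal_table n : n <= 128 -> nth [::] pascal_table n = pascal_row n.
Proof. exact: nth_pascal_rows. Qed.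

Lemma nth_cum_table n : n <= 128 ->
  nth [::] cum_table n = partial_sums BN.zero (pascal_row n).
Proof.
by move=> len; rewrite (nth_map [::]) ?size_pascal_rows // nth_pascal_table.
Qed.

Lemma size_shell_ends N : N <= 128 -> size (shell_ends N) = N.+1.
Proof.
by move=> leN; rewrite /shell_ends nth_cum_table // size_partial_sums size_pascal_row.
Qed.

Lemma nth_shell_ends N k : N <= 128 -> k <= N ->
  BN.to_nat (nth BN.zero (shell_ends N) k) = cumB N k.+1.
Proof.
move=> leN lekN; rewrite /shell_ends nth_cum_table // nth_partial_sums ?size_pascal_row //.
by rewrite add0n; apply: eq_bigr => j _; rewrite nth_pascal_row.
Qed.

Lemma size_sector_ends N M : M <= 128 -> size (sector_ends N M) = M.+1.
Proof.
by move=> leM; rewrite size_map nth_cum_table // size_partial_sums size_pascal_row.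
Qed.

Lemma nth_sector_ends N M w : M <= 128 -> w <= M ->
  BN.to_nat (nth BN.zero (sector_ends N M) w) = cumG N M w.+1.
Proof.
move=> leM lewM; rewrite (nth_map BN.zero) nth_cum_table ?size_partial_sums ?size_pascal_row //.
rewrite Nnat.N2Nat.inj_mul nth_partial_sums ?size_pascal_row // add0n.
rewrite /cumG; congr (_ * _); last by apply: eq_bigr => j _; rewrite nth_pascal_row.
rewrite Nnat.N2Nat.inj_pow Nnat.Nat2N.id -[BN.to_nat _]/2.
by elim: (N - M) => //= n IHn; rewrite expnS -IHn.
Qed.

(** The invariant of the recursions over sectors: [g] is the left end of sector [w], and [gs] lists
    the right ends from that sector on. *)
Definition enumerates (G : nat -> nat) w g gs :=
  [/\ BN.to_nat g = G w, {homo G : i j / i <= j} &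
      forall i, i < size gs -> BN.to_nat (nth BN.zero gs i) = G (w + i).+1].

Lemma enumerates_cons G w g h gs : enumerates G w g (h :: gs) ->
  BN.to_nat h = G w.+1 /\ enumerates G w.+1 h gs.
Proof.
case=> _ homG nthG; have /= hG := nthG 0 isT; rewrite addn0 in hG.
by split=> //; split=> // i lti; rewrite addSnnS -(nthG i.+1).
Qed.

Lemma excessE G p wN w g gs : enumerates G w g gs -> BN.to_nat wN = w ->
  BN.to_nat (excess p wN g gs)
  = \sum_(i < size gs) (w + i) * (minn (BN.to_nat p) (G (w + i).+1) - G (w + i)).
Proof.
elim: gs wN w g => [|h gs IHgs] wN w g enumG def_w /=; first by rewrite big_ord0.
have [hG enumG'] := enumerates_cons enumG; have [gG homG _] := enumG.
rewrite to_nat_leb; case: leqP => [le_pg|_].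
  rewrite big1 // => i _; have := homG w (w + i) (leq_addr _ _).
  by rewrite -gG => le_gG; apply/eqP;
    rewrite muln_eq0 subn_eq0 geq_min (leq_trans le_pg le_gG) orbT.
rewrite to_nat_add to_nat_excess_term big_ord_recl /= addn0 hG gG def_w; congr (_ + _).
rewrite (IHgs _ w.+1) //; last by rewrite Nnat.N2Nat.inj_succ def_w.
by apply: eq_bigr => i _; rewrite addSnnS.
Qed.

Lemma enumerates_sector_ends N M : M <= 128 ->
  enumerates (cumG N M) 0 BN.zero (sector_ends N M).
Proof.
move=> leM; split; [by rewrite /cumG big_ord0 muln0 | exact: leq_cumG |].
by move=> i; rewrite size_sector_ends // => ltiM; rewrite nth_sector_ends.
Qed.

Lemma excess_sector_ends N M p : M <= 128 ->
  BN.to_nat (excess p BN.zero BN.zero (sector_ends N M)) = sector_excess N M (BN.to_nat p).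
Proof.
move=> leM; rewrite (excessE _ (enumerates_sector_ends N leM)) //.
by rewrite size_sector_ends.
Qed.

Lemma mem_shell_ends N p : N <= 128 -> p \in shell_ends N ->
  exists2 k, k <= N & BN.to_nat p = cumB N k.+1.
Proof.
move=> leN /(nthP BN.zero)[k]; rewrite size_shell_ends // => ltkN <-.
by exists k; rewrite ?nth_shell_ends.
Qed.

Lemma unbalancedP N M : 0 < M -> M <= N -> N <= 128 -> unbalanced N M ->
  exists2 k, k <= N.+1 & ~~ (M %| sector_excess N M (cumB N k)).
Proof.
move=> M_gt0 leMN leN; have leM := leq_trans leMN leN.
(* The search recurses on tails of [shell_ends N], hence the generalization to lists contained in
   it. *)
suff search ps : {subset ps <= shell_ends N} ->
    search_defect (BN.of_nat M) (sector_ends N M) ps ->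
    exists2 k, k <= N.+1 & ~~ (M %| sector_excess N M (cumB N k)) by apply: search.
elim: ps => //= p ps IHps sub_ps.
rewrite modulo_eqb ?Nnat.Nat2N.id // excess_sector_ends //.
have [k lekN ->] := mem_shell_ends leN (sub_ps p (mem_head _ _)).
case: ifP => [_|/negbT not_dvd _]; last by exists k.+1.
by apply: IHps => q q_ps; apply: sub_ps; rewrite inE q_ps orbT.
Qed.

Lemma sector_divisibleP G p w g gs ds : enumerates G w g gs -> size ds = size gs ->
    (forall i, i < size gs -> 0 < BN.to_nat (nth BN.zero ds i)) ->
    (forall i, i < size gs -> BN.to_nat (nth BN.zero ds i) %| G (w + i).+1 - G (w + i)) ->
  sector_divisible p g gs ds <-> forall i, i < size gs ->
    BN.to_nat (nth BN.zero ds i) %| minn (BN.to_nat p) (G (w + i).+1) - G (w + i).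
Proof.
elim: gs ds w g => [|h gs IHgs] [|d ds] w g //= enumG [eq_sz] d_gt0 d_dvd.
have [hG enumG'] := enumerates_cons enumG; have [gG homG _] := enumG.
have zero_after i : BN.to_nat p <= G w -> minn (BN.to_nat p) (G (w + i).+1) - G (w + i) = 0.
  move=> le_pG; apply/eqP; rewrite subn_eq0 geq_min.
  by rewrite (leq_trans le_pG (homG _ _ (leq_addr i w))).
rewrite !to_nat_leb gG hG; case: leqP => [le_pG|lt_Gp].
  by split=> // _ i _; rewrite zero_after.
case: leqP => [le_Gp|lt_pG].
  rewrite (IHgs ds w.+1) //; first last.
  - by move=> i lti; rewrite addSnnS; apply: (d_dvd i.+1).
  - by move=> i lti; apply: (d_gt0 i.+1).
  split=> [dvd [_|i lti]|dvd i lti]; last by rewrite addSnnS; apply: (dvd i.+1).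
    by have := d_dvd 0 isT; rewrite addn0 /= (minn_idPr le_Gp).
  by rewrite -addSnnS; apply: dvd.
rewrite modulo_eqb; last exact: (d_gt0 0).
have -> : BN.to_nat (BN.sub p g) = minn (BN.to_nat p) (G (w + 0).+1) - G (w + 0).
  by rewrite addn0 (minn_idPl (ltnW lt_pG)) Nnat.N2Nat.inj_sub gG.
split=> [dvd|dvd]; last exact: (dvd 0).
move=> [|i] lti //.
(* Here [p] lies inside the current sector, so every later sector part is empty. *)
have leG : BN.to_nat p <= G (w + i.+1).
  by rewrite (leq_trans (ltnW lt_pG)) // homG // addnS ltnS leq_addr.
suff -> : minn (BN.to_nat p) (G (w + i.+1).+1) - G (w + i.+1) = 0 by [].
by apply/eqP; rewrite subn_eq0 geq_min leG.
Qed.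

(** The multiplicities are the successive differences of the cumulative parts, so [d] divides all of
    one family exactly when it divides all of the other. *)
Lemma dvd_sector_passive N M w d :
  (forall k, k <= N -> d %| passive_mult N M w k) <->
  (forall k, k <= N -> d %| sector_part N M w (cumB N k.+1)).
Proof.
split=> dvd k lekN.
  rewrite -sum_passive_shells; apply: dvdn_sum => j _; apply: dvd.
  by apply: leq_trans lekN; rewrite -ltnS.
have [k_eq0|k_gt0] := posnP k.
  by have := dvd k lekN; rewrite -sum_passive_shells k_eq0 big_ord1.
have := dvd k lekN; rewrite -sum_passive_shells big_ord_recr /= dvdn_addr //.
rewrite sum_passive_shells -(prednK k_gt0); apply: dvd.
by rewrite (leq_trans (leq_pred k)).
Qed.

Lemma divisible_checkP N M ds : M <= N -> N <= 128 -> size ds = M.+1 ->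
    (forall w, w <= M -> 0 < BN.to_nat (nth BN.zero ds w)) ->
    (forall w, w <= M -> BN.to_nat (nth BN.zero ds w) %| 'C(M, w)) ->
  divisible_check N M ds <-> forall w k, w <= M -> k <= N ->
    BN.to_nat (nth BN.zero ds w) %| passive_mult N M w k.
Proof.
move=> leMN leN size_ds ds_gt0 ds_dvd; have leM := leq_trans leMN leN.
have size_gs := size_sector_ends N leM.
have checkP p : sector_divisible p BN.zero (sector_ends N M) ds <-> forall w, w <= M ->
    BN.to_nat (nth BN.zero ds w) %| sector_part N M w (BN.to_nat p).
  have := @sector_divisibleP _ p 0 _ _ ds (enumerates_sector_ends N leM).
  rewrite size_gs size_ds => /(_ erefl ds_gt0) ->; first by [].
  by move=> w lewM; rewrite add0n cumGS addKn dvdn_mull // ds_dvd.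
split=> [/allP check w k lewM|dvd]; last first.
  apply/allP => p /(mem_shell_ends leN)[k lekN def_p]; apply/checkP => w lewM.
  rewrite def_p; apply: (dvd_sector_passive N M w _).1 lekN => j lejN; exact: dvd.
apply: (dvd_sector_passive N M w _).2 => {k} k lekN.
rewrite -nth_shell_ends //; move: w lewM; apply/checkP; apply: check.
by rewrite mem_nth // size_shell_ends.
Qed.

Lemma hamming_checkP N M : M <= N -> N <= 128 ->
  divisible_check N M (hamming_moduli M) <-> hamming_divisible N M.
Proof.
move=> leMN leN; have leM := leq_trans leMN leN.
have nthE w : BN.to_nat (nth BN.zero (hamming_moduli M) w) = 'C(M, w).
  by rewrite /hamming_moduli nth_pascal_table // nth_pascal_row.
rewrite (divisible_checkP leMN leN) => [|||w lewM]; first 1 last.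
- by rewrite /hamming_moduli nth_pascal_table // size_pascal_row.
- by move=> w lewM; rewrite nthE bin_gt0.
- by rewrite nthE.
by split=> dvd w k lewM lekN; have := dvd w k lewM lekN; rewrite nthE.
Qed.

Lemma local_checkP N M : 0 < M -> M <= N -> N <= 128 ->
  divisible_check N M (local_moduli M) -> locally_balanced N M.
Proof.
move=> M_gt0 leMN leN; have leM := leq_trans leMN leN.
have nthE w : w <= M -> BN.to_nat (nth BN.zero (local_moduli M) w) = M %/ gcdn M w.
  move=> lewM; rewrite /local_moduli (nth_map 0) ?size_iota // nth_iota //.
  by rewrite Nnat.Nat2N.id.
have g_gt0 w : 0 < gcdn M w by rewrite gcdn_gt0 M_gt0.
rewrite (divisible_checkP leMN leN) => [|||w lewM]; first 1 last.
- by rewrite size_map size_iota.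
- by move=> w lewM; rewrite nthE // divn_gt0 // dvdn_leq // dvdn_gcdl.
- rewrite nthE //; have [->|w_gt0] := posnP w; first by rewrite gcdn0 divnn M_gt0 dvd1n.
  (* The modulus divides a full sector because [w * 'C(M, w) = M * 'C(M.-1, w.-1)]. *)
  apply: dvdn_div_gcd => //; rewrite -(prednK w_gt0) -(prednK M_gt0) -mul_bin_diag.
  exact: dvdn_mulr.
move=> dvd w k /andP[w_gt0 ltwM] lekN; have lewM : w <= M by lia.
(* [M] is the product of [M %/ gcdn M w], which divides the multiplicity, and [gcdn M w], which
   divides [w]. *)
rewrite -{1}(divnK (dvdn_gcdl M w)) mulnC dvdn_mul ?dvdn_gcdr //.
by rewrite -(nthE w lewM); apply: dvd.
Qed.

(** * The classification *)

(** For every pair outside the list, the search meets a shell end at which [M] does not divide the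
    accumulated target weight. *)
Lemma unlisted_check_true : unlisted_check. Proof. by vm_compute. Qed.

Lemma listed_check_true : listed_check. Proof. by vm_compute. Qed.

Lemma listed_bounds N M : listed N M -> [/\ 2 <= M < 12, M + 2 <= N & N <= 128].
Proof. by case: M => [|[|[|[|[|[|[|[|[|[|[|[|M]]]]]]]]]]]] //=; move=> lNM; split; lia. Qed.

Lemma listed_asymmetric_listed N M : listed_asymmetric N M -> listed N M.
Proof. by case: M => [|[|[|[|[|[|[|[|[|[|[|[|M]]]]]]]]]]]] //=; lia. Qed.

Lemma listed_asymmetric_moduli N M :
  listed_asymmetric N M -> M \in [:: 4; 5; 6; 7; 8; 11].
Proof. by case: M => [|[|[|[|[|[|[|[|[|[|[|[|M]]]]]]]]]]]] //=. Qed.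

Lemma unlisted_unbalanced N M (pi : {perm bits N}) :
    2 <= M -> M + 2 <= N -> N <= 128 -> ~~ listed N M ->
  optimal_perm M pi -> ~ shellwise_balanced M pi.
Proof.
move=> le2M leMN leN unl opt bal.
have inN : N \in iota 4 125 by rewrite mem_iota; lia.
have inM : M \in iota 2 (N - 3) by rewrite mem_iota; lia.
have := allP (allP unlisted_check_true N inN) M inM; rewrite (negbTE unl).
have M_gt0 : 0 < M by lia.
have le_MN : M <= N by lia.
case/(unbalancedP M_gt0 le_MN leN) => k lekN /negP; apply.
exact: dvd_sector_excess opt bal.
Qed.

Lemma listed_checkP N M : listed N M ->
  if listed_asymmetric N M then locally_balanced N M /\ ~ hamming_divisible N M
  else hamming_divisible N M.
Proof.
move=> lNM; have [/andP[le2M ltM] leMN leN] := listed_bounds lNM.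
have inN : N \in iota 4 125 by rewrite mem_iota; lia.
have inM : M \in iota 2 10 by rewrite mem_iota; lia.
have M_gt0 : 0 < M by lia.
have le_MN : M <= N by lia.
have := allP (allP listed_check_true N inN) M inM; rewrite lNM.
case: ifP => [_ /andP[loc /negP not_ham]|_ /(hamming_checkP le_MN leN) //].
by split; [exact: local_checkP | move/(hamming_checkP le_MN leN)].
Qed.

Lemma listed_balanced N M : listed N M ->
  exists pi : {perm bits N}, optimal_perm M pi /\ shellwise_balanced M pi.
Proof.
move=> lNM; have [_ leMN _] := listed_bounds lNM; have le_MN : M <= N by lia.
have := listed_checkP lNM; case: ifP => [asym [loc _]|_ ham].
  exact: balanced_of_locally_balanced (listed_asymmetric_moduli asym) loc.
have [pi [opt sym]] := hamming_symmetric_exists le_MN ham.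
by exists pi; split=> //; apply: balanced_of_hamming_symmetric.
Qed.

(** The cardinal is rewritten as a double sum of indicators over [iota 0 129], which can be
    evaluated. *)
Lemma card_listed_asymmetric :
  #|[set p : 'I_129 * 'I_129 | listed_asymmetric p.1 p.2]| = 58.
Proof.
rewrite -sum1_card big_mkcond.
rewrite (eq_bigr (fun p : 'I_129 * 'I_129 => nat_of_bool (listed_asymmetric p.1 p.2))).
  rewrite -(pair_bigA _ (fun i j : 'I_129 => nat_of_bool (listed_asymmetric i j))) /=.
  transitivity (sumn [seq sumn [seq nat_of_bool (listed_asymmetric i j) | j <- iota 0 129]
                     | i <- iota 0 129]); last by vm_compute.
  rewrite sumnE big_map -[iota 0 129]/(index_iota 0 129) big_mkord.
  by apply: eq_bigr => i _; rewrite sumnE big_map big_mkord.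
by move=> p _; rewrite inE; case: listed_asymmetric.
Qed.

Theorem mainTheorem8 (R : realType) :
  (forall N M : nat, 2 <= M -> M + 2 <= N -> N <= 128 ->
    ((exists pi : {perm bits N},
        optimal_perm M pi /\ identical_marginals R M pi) <-> listed N M) /\
    ((exists pi : {perm bits N},
        optimal_perm M pi /\ shellwise_balanced M pi) <-> listed N M)) /\
  (forall N M : nat, 2 <= M -> M + 2 <= N -> N <= 128 ->
    M \notin [:: 2; 3; 4; 5; 6; 7; 8; 11] ->
    ~ (exists pi : {perm bits N},
         optimal_perm M pi /\ identical_marginals R M pi)) /\
  (forall N M : nat, listed N M ->
    (hamming_divisible N M <->
     exists pi : {perm bits N}, optimal_perm M pi /\ hamming_symmetric M pi)) /\
  (forall N M : nat,
    (listed N M /\ ~ hamming_divisible N M /\ locally_balanced N M) <->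
    listed_asymmetric N M) /\
  #|[set p : 'I_129 * 'I_129 | listed_asymmetric p.1 p.2]| = 58 /\
  (forall N M : nat, listed N M -> ~~ listed_asymmetric N M ->
    hamming_divisible N M).
Proof.
have balanced N M : 2 <= M -> M + 2 <= N -> N <= 128 ->
    (exists pi : {perm bits N}, optimal_perm M pi /\ shellwise_balanced M pi)
    <-> listed N M.
  move=> le2M leMN leN; split=> [[pi [opt bal]]|]; last exact: listed_balanced.
  by apply/contraT => unl; case: (unlisted_unbalanced le2M leMN leN unl opt bal).
have marginals N M : 2 <= M -> M + 2 <= N -> N <= 128 ->
    (exists pi : {perm bits N}, optimal_perm M pi /\ identical_marginals R M pi)
    <-> listed N M.
  move=> le2M leMN leN; have le_MN : M <= N by lia.
  rewrite -(balanced N M le2M leMN leN).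
  by split=> -[pi [opt /(identical_marginals_balanced _ _ le_MN) bal]]; exists pi.
split; first by move=> N M le2M leMN leN; split; [exact: marginals | exact: balanced].
split.
  move=> N M le2M leMN leN notM /(marginals N M le2M leMN leN).
  (* For such [M], [listed N M] reduces to [false]. *)
  by move: notM; clear; case: M => [|[|[|[|[|[|[|[|[|[|[|[|M]]]]]]]]]]]] //=.
split.
  move=> N M lNM; have [_ leMN _] := listed_bounds lNM; have le_MN : M <= N by lia.
  split; first exact: hamming_symmetric_exists.
  by case=> pi [opt sym]; apply: hamming_divisible_of_symmetric opt sym.
split.
  move=> N M; split=> [[lNM [not_ham _]]|asym].
    (* A listed pair outside [listed_asymmetric] would be Hamming divisible. *)
    by have := listed_checkP lNM; case: ifP.
  have lNM := listed_asymmetric_listed asym.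
  by have := listed_checkP lNM; rewrite asym => -[loc not_ham].
split; first exact: card_listed_asymmetric.
by move=> N M lNM /negbTE not_asym; have := listed_checkP lNM; rewrite not_asym.
Qed.
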